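(* Fix $\bar i\in I$. Let $C$ be a core block and let $K=K_{\bar i}(C)$. Suppose that $\boldsymbol m$ is a multicore with core block $C$ and weight $$w(\boldsymbol m)=w(C)+hr$$ with $0\le h\le K$. Then $d_{\bar i}(\boldsymbol m)\ge K-h$.
   Context: Setting. Let $r\ge1$, $\mathbb F$ a field, $2\le e<\infty$, $q\in\mathbb F$ a primitive $e$-th root of unity, $\kappa=(\kappa_1,\dots,\kappa_r)\in\mathbb Z^r$, $I=\{0,\dots,e-1\}$ identified with $\mathbb Z/e\mathbb Z$. $\mathcal H_{r,n}$ is the Ariki-Koike algebra over $\mathbb F$ (deformation of $\mathbb F[C_r\wr\mathfrak S_n]$) with parameters $q$ and $Q_j=q^{\kappa_j}$. A multicharge is any $\mathrm a\in\mathbb Z^r$ with $a_j\equiv\kappa_j \pmod e$ for all $j$. Multipartitions and blocks. An $r$-multipartition of $n$ is an $r$-tuple $\boldsymbol\lambda=(\lambda^{(1)},\dots,\lambda^{(r)})$ of partitions of total size $n$, with nodes $(b,c,j)$, $c\le\lambda^{(j)}_b$; the node $(b,c,j)$ has residue $\kappa_j+c-b \bmod e$. $\boldsymbol\lambda$ lies in the block of $\mathcal H_{r,n}$ containing its Specht module; two $r$-multipartitions of $n$ lie in the same block iff their multisets of residues coincide. Hub, weight. $\delta_i^j(\boldsymbol\lambda)$ is the number of removable minus the number of addable nodes of residue $i$ in component $j$; $\delta_i(\boldsymbol\lambda)=\sum_j\delta_i^j(\boldsymbol\lambda)$; the hub is $(\delta_i(\boldsymbol\lambda))_{i\in I}$.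 With $c_i(\boldsymbol\lambda)$ the number of nodes of residue $i$, the weight is $w(\boldsymbol\lambda)=\sum_{j=1}^r c_{\kappa_j}(\boldsymbol\lambda)-\frac12\sum_{i\in I}(c_i(\boldsymbol\lambda)-c_{i+1}(\boldsymbol\lambda))^2$ (subscripts mod $e$). Both depend only on the block; $w(C)$ is the weight of any multipartition in $C$. Abacus. For a multicharge $\mathrm a$, the $\beta$-numbers of $\lambda^{(j)}$ are $\lambda^{(j)}_m+a_j-m$ ($m\ge1$). The $e$-abacus of $\lambda^{(j)}$ has runners $0,\dots,e-1$, with a bead at position $xe+l$ (runner $l$, level $x$) for each $\beta$-number $xe+l$. A multicore is a multipartition all of whose components are $e$-cores (all beads pushed up as high as possible). $\ell^{\mathrm a}_{lj}(\boldsymbol\lambda)$ is the level of the lowest bead (largest $\beta$-number) on runner $l$ of the abacus of $\lambda^{(j)}$. For a multicore $\boldsymbol\mu$, $d_i(\boldsymbol\mu)=\min\{\delta_i^j(\boldsymbol\mu): 1\le j\le r\}$. Core blocks. A block is a core block if every multipartition in it is a multicore; equivalently, no block of any $\mathcal H_{r,m}$ (same $q,\kappa$) has the same hub and smaller weight. For each hub that occurs there is exactly one core block with that hub; the core block of a multipartition is the core block with the same hub. $K_i(C)$. For a core block $C$ and a multicharge $\mathrm a$, a base tuple of $C$ with respect to $\mathrm a$ is $(b_0,\dots,b_{e-1})\in\mathbb Z^e$ such that $\ell^{\mathrm a}_{lj}(\boldsymbol\mu)\in\{b_l,b_l+1\}$ for all $l\in I$, all $j$ and all $\boldsymbol\mu\in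 C$. Multicharges admitting a base tuple exist; fix one. Given $i$, choose a base tuple with respect to this $\mathrm a$ with $b_i$ as large as possible and $b_{i-1}$ (meaning $b_{e-1}$ if $i=0$) as small as possible. Then $K_i(C)=b_i-b_{i-1}-1$ if $i\ne0$ and $K_0(C)=b_0-b_{e-1}-2$. *)

(* Defs.v *)
From HB Require Import structures.
From mathcomp Require Import all_boot all_order all_algebra.

Set Implicit Arguments.
Unset Strict Implicit.
Unset Printing Implicit Defensive.

Import Order.TTheory GRing.Theory Num.Theory.

Local Open Scope ring_scope.

Definition is_partition (s : seq nat) : bool := sorted geq s && (0%N \notin s).

Record partition : Type :=
  Partition { parts :> seq nat; partsP : is_partition parts }.

HB.instance Definition _ := [isSub for parts].
HB.instance Definition _ := [Countable of partition by <:].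

(* The part lambda_m for m >= 1; it is 0 beyond the length of lambda. *)
Definition part (p : partition) (m : nat) : nat := nth 0%N p m.-1.

(* Rows, columns and parts are numbered from 1. *)
Definition pnodes (p : partition) : seq (nat * nat) :=
  [seq (b, c) | b <- iota 1 (size p), c <- iota 1 (part p b)].

Definition removable_nodes (p : partition) : seq (nat * nat) :=
  [seq (b, part p b) | b <- iota 1 (size p) & (part p b.+1 < part p b)%N].

Definition addable_nodes (p : partition) : seq (nat * nat) :=
  [seq (b, (part p b).+1)
     | b <- iota 1 (size p).+1 & (b == 1)%N || (part p b < part p b.-1)%N].

Definition multipartition (r : nat) : Type := {ffun 'I_r -> partition}.

Definition msize (r : nat) (la : multipartition r) : nat :=
  (\sum_(j < r) sumn (la j))%N.

(* The node (b, c, j) is encoded as ((b, c), j). *)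
Definition nodes (r : nat) (la : multipartition r) : seq (nat * nat * 'I_r) :=
  [seq (bc, j) | j <- enum 'I_r, bc <- pnodes (la j)].

Section ResiduesAndBlocks.

Variables (r e : nat) (kappa : 'I_r -> int).

(* The representative in {0, ..., e - 1} of kappa_j + c - b modulo e. *)
Definition residue (x : nat * nat * 'I_r) : int :=
  ((kappa x.2 + x.1.2%:Z - x.1.1%:Z) %% e%:Z)%Z.

Definition residues (la : multipartition r) : seq int :=
  [seq residue x | x <- nodes la].

(* Below, an index i : int stands for its class modulo e. *)
Definition has_residue (i : int) (x : nat * nat * 'I_r) : bool :=
  residue x == (i %% e%:Z)%Z.

Definition content (i : int) (la : multipartition r) : nat :=
  count (has_residue i) (nodes la).

Definition delta_comp (i : int) (j : 'I_r) (la : multipartition r) : int :=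
  (count (fun x => has_residue i (x, j)) (removable_nodes (la j)))%:Z
  - (count (fun x => has_residue i (x, j)) (addable_nodes (la j)))%:Z.

Definition delta (i : int) (la : multipartition r) : int :=
  \sum_(j < r) delta_comp i j la.

Definition same_hub (la mu : multipartition r) : Prop :=
  forall i : 'I_e, delta i%:Z la = delta i%:Z mu.

Definition weight (la : multipartition r) : rat :=
  \sum_(j < r) (content (kappa j) la)%:R
  - 2%:R^-1 * \sum_(i < e)
      ((content i%:Z la)%:R - (content (i%:Z + 1) la)%:R) ^+ 2.

Definition min_delta (r_gt0 : (0 < r)%N) (i : int) (mu : multipartition r)
    : int :=
  \big[Order.min/delta_comp i (Ordinal r_gt0) mu]_(j < r) delta_comp i j mu.

(* A block of the Ariki-Koike algebra H_{r,n} is identified with the set of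
   multipartitions of n whose Specht modules lie in it; by the theorem of
   Graham-Lehrer and Lyle-Mathas these sets are exactly the classes of
   multipartitions of n with equal multisets of residues.  In particular they
   depend on the field and on q only through e. *)
Definition is_block (n : nat) (C : multipartition r -> Prop) : Prop :=
  exists2 la : multipartition r, msize la = n &
    forall mu : multipartition r,
      C mu <-> msize mu = n /\ perm_eq (residues la) (residues mu).

(* The weight and the hub are constant on a block. *)
Definition block_has_weight (C : multipartition r -> Prop) (w : rat) : Prop :=
  exists2 mu, C mu & weight mu = w.

Definition block_has_hub_of (C : multipartition r -> Prop)
    (la : multipartition r) : Prop :=
  exists2 mu, C mu & same_hub la mu.

End ResiduesAndBlocks.

(* There is a bead at position x on the abacus of p with charge a. *)
Definition bead (p : partition) (a x : int) : Prop :=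
  exists2 m : nat, (0 < m)%N & x = (part p m)%:Z + a - m%:Z.

(* Runners extend infinitely upwards (towards negative levels) and are full far
   enough up, so beads are as high as possible iff there is never a gap
   immediately above a bead. *)
Definition is_core (e : nat) (p : partition) : Prop :=
  forall a x : int, bead p a x -> bead p a (x - e%:Z).

Definition is_multicore (r e : nat) (mu : multipartition r) : Prop :=
  forall j : 'I_r, is_core e (mu j).

Definition is_core_block (r e : nat) (kappa : 'I_r -> int) (n : nat)
    (C : multipartition r -> Prop) : Prop :=
  is_block e kappa n C /\ forall mu, C mu -> is_multicore e mu.

Definition is_multicharge (r e : nat) (kappa a : 'I_r -> int) : Prop :=
  forall j : 'I_r, (a j = kappa j %[mod e%:Z])%Z.

(* x is the level of the lowest bead on runner l. *)
Definition lowest_level (e : nat) (p : partition) (a : int) (l : 'I_e)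
    (x : int) : Prop :=
  bead p a (x * e%:Z + l%:Z)
  /\ forall y : int, bead p a (y * e%:Z + l%:Z) -> y <= x.

Definition is_base_tuple (r e : nat) (C : multipartition r -> Prop)
    (a : 'I_r -> int) (b : 'I_e -> int) : Prop :=
  forall (l : 'I_e) (j : 'I_r) (mu : multipartition r), C mu ->
    lowest_level (mu j) (a j) l (b l)
    \/ lowest_level (mu j) (a j) l (b l + 1).

(* K = K_i(C), computed with the multicharge a.  Here ord_pred i is i - 1
   modulo e, so e - 1 if i = 0. *)
Definition is_K (r e : nat) (C : multipartition r -> Prop) (a : 'I_r -> int)
    (i : 'I_e) (K : int) : Prop :=
  exists b : 'I_e -> int,
    [/\ is_base_tuple C a b,
        forall b' : 'I_e -> int, is_base_tuple C a b' -> b' i <= b i,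
        forall b' : 'I_e -> int, is_base_tuple C a b' ->
          b (ord_pred i) <= b' (ord_pred i)
      & K = b i - b (ord_pred i) - (if i == 0%N :> nat then 2 else 1)].

(* Main.v *)
(* Write L_lj for the level of the lowest bead on runner l of component j of m,
   and b for a base tuple of C.  Then delta_i^j(m) = L_ij - L_(i-1)j - [i = 0],
   and equality of hubs says that sum_j L_lj is the same for m and for the
   multipartitions of C.  The contents of two multipartitions with the same hub
   differ by a constant, here (w(m) - w(C)) / r = h, and counting the nodes of
   residue 0 on the abacus gives
     2 h = sum_(l, j) (L_lj - b_l) (L_lj - b_l - 1).
   All summands are nonnegative.  With x = L_ij - b_i and y = L_(i-1)j - b_(i-1),
   the estimates x (x - 1) >= - 2 x and y (y - 1) >= 2 (y - 1) give
   h >= y - x - 1, which is the claim. *)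
Require Import Defs.
From HB Require Import structures.
From mathcomp Require Import all_boot all_order all_algebra.
From mathcomp Require Import zify ring.

Set Implicit Arguments.
Unset Strict Implicit.
Unset Printing Implicit Defensive.

Import Order.TTheory GRing.Theory Num.Theory.

Local Open Scope ring_scope.

(** * Beta-numbers of a partition and the runners they lie on *)

(* Rows are numbered from 0 here. *)
Definition beta (p : Defs.partition) (a : int) (b : nat) : int :=
  (part p b.+1)%:Z + a - b.+1%:Z.

Definition on_runner (e : nat) (i x : int) : bool := (x == i %[mod e%:Z])%Z.

Lemma part_leS (p : Defs.partition) (b : nat) : (part p b.+2 <= part p b.+1)%N.
Proof.
have /andP [/(sortedP 0%N) p_sorted _] := partsP p.
have [b_lt|b_ge] := ltnP b.+1 (size p); first exact: p_sorted.
by rewrite /part nth_default.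
Qed.

Lemma part_eq0 (p : Defs.partition) (b : nat) :
  (part p b.+1 == 0%N) = (size p <= b)%N.
Proof.
have /andP [_ p_pos] := partsP p.
have [b_ge|b_lt] := leqP (size p) b; first by rewrite /part nth_default.
by apply: contraNF p_pos => /eqP <-; exact: mem_nth.
Qed.

Lemma beta_vacuum (p : Defs.partition) (a : int) (b : nat) :
  (size p <= b)%N -> beta p a b = a - b.+1%:Z.
Proof. by rewrite /beta -part_eq0 => /eqP ->; rewrite add0r. Qed.

Lemma beta_decreasing (p : Defs.partition) (a : int) (b c : nat) :
  (b < c)%N -> beta p a c < beta p a b.
Proof.
elim: c => // c IHc; rewrite ltnS leq_eqVlt.
have lt_c : beta p a c.+1 < beta p a c.
  by have := part_leS p c; rewrite /beta; lia.
by case/predU1P=> [->|/IHc] //; exact: lt_trans.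
Qed.

Lemma on_runnerD (e : nat) (i x z : int) :
  on_runner e (i + z) (x + z) = on_runner e i x.
Proof. exact: eqz_modDr. Qed.

(** * Contents as sums of integer quotients *)

Lemma divz_succ (e : nat) (x : int) : (0 < e)%N ->
  ((x + 1) %/ e%:Z)%Z - (x %/ e%:Z)%Z = (on_runner e 0 (x + 1))%:Z.
Proof.
move=> e_gt0; rewrite /on_runner eqz_mod_dvd subr0.
have e_neq0 : e%:Z != 0 by lia.
have [/dvdzP [k x1E]|ndvd] := boolP (e%:Z %| x + 1)%Z.
  have -> : x = (k - 1) * e%:Z + (e%:Z - 1) by lia.
  rewrite -addrA subrK divzMDl // divzMDl // divzz e_neq0 divz_small; first by lia.
  by apply/andP; split; lia.
have r_ge0 := modz_ge0 x e_neq0; have r_lt := ltz_mod x e_neq0.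
have x1E : x + 1 = (x %/ e%:Z)%Z * e%:Z + ((x %% e%:Z)%Z + 1).
  by rewrite addrA -divz_eq.
rewrite x1E divzMDl // [((_ + 1) %/ _)%Z]divz_small ?addr0 ?subrr //.
apply/andP; split; first by lia.
(* A remainder equal to [e - 1] would make [x + 1] divisible by [e]. *)
rewrite lt_neqAle; apply/andP; split; last by lia.
apply: contra ndvd => /eqP rE; rewrite x1E rE.
by apply/dvdzP; exists ((x %/ e)%Z + 1); lia.
Qed.

Lemma divz_shift (e : nat) (i x : int) : (0 < e)%N ->
  ((x - i) %/ e%:Z)%Z - ((x - (i + 1)) %/ e%:Z)%Z = (on_runner e i x)%:Z.
Proof.
move=> e_gt0; have := divz_succ (x - (i + 1)) e_gt0.
have -> : x - (i + 1) + 1 = x - i by ring.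
by move=> ->; rewrite -(on_runnerD e i x (- i)) subrr.
Qed.

(** The quotient grows by one exactly at each counted [c], so the count telescopes. *)
Lemma count_row (e : nat) (i y : int) (k : nat) : (0 < e)%N ->
  (count (fun c => on_runner e i (y + c%:Z)) (iota 1 k))%:Z
  = ((y + k%:Z - i) %/ e%:Z)%Z - ((y - i) %/ e%:Z)%Z.
Proof.
move=> e_gt0; elim: k => [|k IHk]; first by rewrite addr0 subrr.
rewrite -[k.+1]addn1 iotaD count_cat PoszD IHk /= addn0 add1n addn1.
have := divz_succ (y + k%:Z - i) e_gt0.
have -> : y + k%:Z - i + 1 = y + k.+1%:Z - i by lia.
rewrite -(on_runnerD e i (y + k.+1%:Z) (- i)) subrr.
set u := on_runner _ _ _; lia.
Qed.

(** Residues only see [kappa] modulo [e], so the multicharge can replace it. The last node of a row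
    then has the runner of the row's beta-number as its residue. *)
Lemma has_residueE (r e : nat) (kappa a : 'I_r -> int) (i : int) (j : 'I_r)
    (b c : nat) : is_multicharge e kappa a ->
  has_residue e kappa i (b, c, j) = on_runner e i (a j + c%:Z - b%:Z).
Proof.
move=> a_mc; rewrite /has_residue /residue /on_runner /=.
by rewrite -2!addrA -[in RHS]modzDml a_mc modzDml.
Qed.

Lemma count_sumz (T : Type) (P : pred T) (s : seq T) :
  (count P s)%:Z = \sum_(x <- s) (P x)%:Z.
Proof.
by elim: s => [|x s IHs]; rewrite ?big_nil // big_cons /= PoszD IHs.
Qed.

(** Along a row, the integers [a + c - b] fill the interval from the beta-number the row would have
    if empty (excluded) to its actual one (included). Rows beyond [size p] contribute 0, which
    leaves [N] free. *)
Lemma content_comp (p : Defs.partition) (e N : nat) (i a : int) :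
  (0 < e)%N -> (size p <= N)%N ->
  (count (fun x => on_runner e i (a + x.2%:Z - x.1%:Z)) (pnodes p))%:Z
  = \sum_(0 <= b < N) (((beta p a b - i) %/ e%:Z)%Z
                       - ((a - b.+1%:Z - i) %/ e%:Z)%Z).
Proof.
move=> e_gt0 size_le; rewrite count_sumz big_allpairs_dep.
rewrite (big_cat_nat _ size_le) //= [X in _ + X]big_nat_cond.
rewrite [X in _ + X]big1 ?addr0; last first.
  by move=> b /andP [/andP [/beta_vacuum -> _] _]; rewrite subrr.
rewrite -[1%N]addn0 iotaDl big_map /index_iota subn0; apply: eq_bigr => b _.
have <- := count_sumz (fun c => on_runner e i (a + c%:Z - (1 + b)%N%:Z)).
rewrite (eq_count (a2 := fun c => on_runner e i (a - b.+1%:Z + c%:Z))); last first.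
  by move=> c; rewrite addrAC add1n.
rewrite count_row // /beta add1n; congr ((_ %/ _)%Z - _); ring.
Qed.

Lemma contentE (r e : nat) (kappa a : 'I_r -> int) (i : int) (N : 'I_r -> nat)
    (la : multipartition r) :
  (0 < e)%N -> is_multicharge e kappa a -> (forall j, size (la j) <= N j)%N ->
  (content e kappa i la)%:Z
  = \sum_(j < r) \sum_(0 <= b < N j) (((beta (la j) (a j) b - i) %/ e%:Z)%Z
                       - ((a j - b.+1%:Z - i) %/ e%:Z)%Z).
Proof.
move=> e_gt0 a_mc size_le; rewrite /content count_sumz big_allpairs_dep /=.
rewrite big_enum; apply: eq_bigr => j _.
rewrite -(content_comp i (a j) e_gt0 (size_le j)) count_sumz; apply: eq_bigr.
by case=> b c _; rewrite (has_residueE _ _ _ _ a_mc).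
Qed.

(** * The hub as a difference of bead counts on adjacent runners *)

Lemma removable_count (p : Defs.partition) (e N : nat) (i a : int) :
  (size p <= N)%N ->
  (count (fun x => on_runner e i (a + x.2%:Z - x.1%:Z)) (removable_nodes p))%:Z
  = \sum_(0 <= b < N | (part p b.+2 < part p b.+1)%N)
      (on_runner e i (beta p a b))%:Z.
Proof.
move=> size_le; rewrite count_sumz big_map big_filter.
rewrite [RHS]big_mkcond (big_cat_nat _ size_le) //= [X in _ + X]big_nat_cond.
rewrite [X in _ + X]big1 ?addr0 -?big_mkcond; last first.
  move=> b /andP [/andP [b_ge _] _].
  by move: b_ge; rewrite -part_eq0 => /eqP ->; rewrite ltn0.
rewrite -[1%N]addn0 iotaDl big_map /index_iota subn0 /=.
by apply: eq_big => b; rewrite add1n // /beta addrC [a + _]addrC addrC.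
Qed.

(** An addable node lies one step past the end of its row, so residue [i] puts the bead on runner
    [i - 1]. The first row always has one; a later row has one iff the row above is strictly longer,
    which is the condition for a removable node in that row above. *)
Lemma addable_count (p : Defs.partition) (e N : nat) (i a : int) :
  (size p <= N)%N ->
  (count (fun x => on_runner e i (a + x.2%:Z - x.1%:Z)) (addable_nodes p))%:Z
  = (on_runner e (i - 1) (beta p a 0))%:Z
  + \sum_(0 <= b < N | (part p b.+2 < part p b.+1)%N)
      (on_runner e (i - 1) (beta p a b.+1))%:Z.
Proof.
move=> size_le; rewrite count_sumz big_map big_filter.
rewrite [\sum_(0 <= b < N | _) _]big_mkcond (big_cat_nat _ size_le) //=.
rewrite [X in _ + (_ + X)]big_nat_cond.
rewrite [X in _ + (_ + X)]big1 ?addr0 -?big_mkcond; last first.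
  move=> b /andP [/andP [b_ge _] _].
  by move: b_ge; rewrite -part_eq0 => /eqP ->; rewrite ltn0.
have shift (b : nat) :
  on_runner e i (a + (part p b.+1).+1%:Z - b.+1%:Z)
  = on_runner e (i - 1) (beta p a b).
  rewrite -(on_runnerD e (i - 1) _ 1) subrK /beta; congr on_runner; lia.
rewrite big_cons /= shift; congr (_ + _).
rewrite -[2%N]addn0 iotaDl big_map /index_iota subn0 /=.
by apply: eq_big => b; rewrite ?add2n ?shift.
Qed.

(** Where two consecutive rows are equal, their beta-numbers differ by 1, so the upper one is on
    runner [i] iff the lower one is on runner [i - 1]. These terms cancel, and both sums may run
    over all rows. The second has one more row because of the addable node below the last removable
    one. *)
Lemma delta_compE (r e : nat) (kappa a : 'I_r -> int) (N : nat) (i : int)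
    (j : 'I_r) (la : multipartition r) :
  is_multicharge e kappa a -> (size (la j) <= N)%N ->
  delta_comp e kappa i j la
  = \sum_(0 <= b < N) (on_runner e i (beta (la j) (a j) b))%:Z
    - \sum_(0 <= b < N.+1) (on_runner e (i - 1) (beta (la j) (a j) b))%:Z.
Proof.
move=> a_mc size_le; rewrite /delta_comp.
have resE : (fun x => has_residue e kappa i (x, j))
            =1 (fun x => on_runner e i (a j + x.2%:Z - x.1%:Z)).
  by case=> b c; exact: has_residueE.
rewrite !(eq_count resE) (removable_count _ _ _ size_le).
rewrite (addable_count _ _ _ size_le) big_nat_recl //.
pose strict b := (part (la j) b.+2 < part (la j) b.+1)%N.
rewrite [X in _ = X - _](bigID strict).
rewrite [X in _ = _ - (_ + X)](bigID strict).
rewrite /= [X in _ = _ + X - _](eq_bigr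
  (fun b => (on_runner e (i - 1) (beta (la j) (a j) b.+1))%:Z)); first by ring.
move=> b; rewrite /strict -leqNgt => part_le; rewrite -[in LHS](subrK 1 i).
rewrite -(on_runnerD e (i - 1) (beta _ _ _) 1); congr (on_runner _ _ _)%:Z.
have := part_leS (la j) b; rewrite /beta; lia.
Qed.

(** * Comparison of two multipartitions with the same hub *)

Lemma on_runner_modl (e : nat) (i x : int) :
  on_runner e (i %% e%:Z)%Z x = on_runner e i x.
Proof. by rewrite /on_runner modz_mod. Qed.

Lemma on_runner_ord (e : nat) (l l' : 'I_e) (y : int) :
  on_runner e l%:Z (y * e%:Z + l'%:Z) = (l == l').
Proof.
have l_lt := ltn_ord l; have l'_lt := ltn_ord l'.
by rewrite /on_runner modzMDl !modz_small 1?eq_sym //; lia.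
Qed.

Lemma sum_on_runner (e : nat) (x : int) : (0 < e)%N ->
  \sum_(l < e) (on_runner e l%:Z x)%:Z = 1.
Proof.
move=> e_gt0; have e_neq0 : e%:Z != 0 by lia.
have r_ge0 := modz_ge0 x e_neq0.
have r_lt : (`|(x %% e%:Z)%Z| < e)%N by have := ltz_mod x e_neq0; lia.
have onE (l : 'I_e) : on_runner e l%:Z x = (l == Ordinal r_lt).
  rewrite -(on_runner_ord _ _ (x %/ e%:Z)%Z) /= gez0_abs //.
  by rewrite -divz_eq.
rewrite (eq_bigr _ (fun l _ => congr1 (fun u : bool => u%:Z) (onE l))).
by rewrite (bigD1 (Ordinal r_lt)) //= eqxx big1 // => l /negPf ->.
Qed.

Section SameHub.

Variables (r e : nat) (kappa a : 'I_r -> int) (N : 'I_r -> nat).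
Variables (la mu : multipartition r).
Hypotheses (e_gt0 : (0 < e)%N) (a_mc : is_multicharge e kappa a).
Hypotheses (la_size : (forall j, size (la j) <= N j)%N).
Hypotheses (mu_size : (forall j, size (mu j) <= N j)%N).
Hypothesis hub_eq : same_hub e kappa la mu.

(** Let [X] be the difference of the two bead counts on a runner. Equal hubs make [X] constant
    around the runners, and its sum over all runners is 0 because both sides have the same number of
    rows. *)
Lemma same_hub_runner (z : int) :
  \sum_(j < r) \sum_(0 <= b < N j) (on_runner e z (beta (la j) (a j) b))%:Z
  = \sum_(j < r) \sum_(0 <= b < N j) (on_runner e z (beta (mu j) (a j) b))%:Z.
Proof.
pose S (nu : multipartition r) x :=
  \sum_(j < r) \sum_(0 <= b < N j) (on_runner e x (beta (nu j) (a j) b))%:Z.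
pose X x := S la x - S mu x.
(* The extra row of index [N j] is empty, so its term is the same for [la] and [mu]. *)
have deltaE (nu : multipartition r) (i : int) :
    (forall j, size (nu j) <= N j)%N ->
  delta e kappa i nu = S nu i - S nu (i - 1)
     - \sum_(j < r) (on_runner e (i - 1) (a j - (N j).+1%:Z))%:Z.
  move=> nu_size; rewrite /delta /S -!sumrB; apply: eq_bigr => j _.
  rewrite (delta_compE i a_mc (nu_size j)) big_nat_recr //= beta_vacuum //.
  by rewrite opprD addrA.
have X_step (k : nat) : (k < e)%N -> X k%:Z = X (k%:Z - 1).
  move=> k_lt; have := hub_eq (Ordinal k_lt); rewrite /= !deltaE // /X.
  set u := \sum_(j < r) _; lia.
have X_const (k : nat) : (k < e)%N -> X k%:Z = X (-1).
  elim: k => [|k IHk] k_lt; first by rewrite X_step.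
  by rewrite X_step // -addn1 PoszD addrK IHk // ltnW.
have X_sum : \sum_(k < e) X k%:Z = 0.
  rewrite /X sumrB /S exchange_big [X in _ - X]exchange_big /= -sumrB.
  apply: big1 => j _.
  rewrite exchange_big [X in _ - X]exchange_big /=.
  by rewrite -sumrB big1 // => b _; rewrite !sum_on_runner ?subrr.
have X_eq0 : X (-1) = 0.
  move: X_sum; rewrite (eq_bigr (fun=> X (-1))) => [|k _]; last exact: X_const.
  by rewrite sumr_const card_ord => /eqP; rewrite mulrn_eq0 eqn0Ngt e_gt0 => /eqP.
have z_ge0 : 0 <= (z %% e%:Z)%Z by apply: modz_ge0; lia.
have z_lt : (`|(z %% e%:Z)%Z| < e)%N by have := ltz_pmod z (_ : 0 < e%:Z); lia.
apply/eqP; rewrite -subr_eq0; apply/eqP.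
transitivity (X (z %% e%:Z)%Z); last by rewrite -(gez0_abs z_ge0) X_const.
by congr (_ - _); apply: eq_bigr => j _; apply: eq_bigr => b _;
  rewrite on_runner_modl.
Qed.

(** Replacing [i] by [i + 1] lowers the quotient sum by the number of beads on runner [i], which is
    the same for [la] and [mu]. Hence the difference of contents does not depend on [i] and can be
    read off at 0. *)
Lemma same_hub_content (i : int) :
  (content e kappa i la)%:Z - (content e kappa i mu)%:Z
  = \sum_(j < r) \sum_(0 <= b < N j) ((beta (la j) (a j) b) %/ e%:Z)%Z
    - \sum_(j < r) \sum_(0 <= b < N j) ((beta (mu j) (a j) b) %/ e%:Z)%Z.
Proof.
pose S (nu : multipartition r) x :=
  \sum_(j < r) \sum_(0 <= b < N j) ((beta (nu j) (a j) b - x) %/ e%:Z)%Z.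
have contentS (x : int) : (content e kappa x la)%:Z - (content e kappa x mu)%:Z
    = S la x - S mu x.
  rewrite (contentE x e_gt0 a_mc la_size) (contentE x e_gt0 a_mc mu_size).
  rewrite /S -!sumrB; apply: eq_bigr => j _; rewrite -!sumrB.
  by apply: eq_bigr => b _; rewrite opprB addrA subrK.
have S_step (x : int) : S la x - S mu x = S la (x + 1) - S mu (x + 1).
  have stepE (nu : multipartition r) : S nu x - S nu (x + 1)
    = \sum_(j < r) \sum_(0 <= b < N j) (on_runner e x (beta (nu j) (a j) b))%:Z.
    rewrite /S -sumrB; apply: eq_bigr => j _; rewrite -sumrB.
    by apply: eq_bigr => b _; rewrite divz_shift.
  have := same_hub_runner x; rewrite -!stepE; lia.
have S0 (nu : multipartition r) : S nu 0
    = \sum_(j < r) \sum_(0 <= b < N j) ((beta (nu j) (a j) b) %/ e%:Z)%Z.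
  by apply: eq_bigr => j _; apply: eq_bigr => b _; rewrite subr0.
rewrite contentS -!S0; elim/int_rect: i => [|k <-|k <-] //.
  by rewrite -addn1 PoszD -S_step.
by rewrite [in LHS]S_step -addn1 PoszD opprD subrK.
Qed.

(** All contents shift by the same integer: the squared differences are unchanged and each of the
    [r] linear terms gains the shift once. *)
Lemma same_hub_weight :
  weight e kappa la - weight e kappa mu
  = (\sum_(j < r) \sum_(0 <= b < N j) ((beta (la j) (a j) b) %/ e%:Z)%Z
    - \sum_(j < r) \sum_(0 <= b < N j) ((beta (mu j) (a j) b) %/ e%:Z)%Z)%:~R
    * r%:R.
Proof.
set s := (_ - _ as X in X%:~R).
have contentE (i : int) : (content e kappa i la)%:R
    = (content e kappa i mu)%:R + s%:~R :> rat.
  by rewrite /s -(same_hub_content i) rmorphB /= addrC subrK.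
rewrite /weight.
have -> : \sum_(j < r) (content e kappa (kappa j) la)%:R
    = \sum_(j < r) (content e kappa (kappa j) mu)%:R + s%:~R * r%:R :> rat.
  rewrite (eq_bigr _ (fun j _ => contentE (kappa j))) big_split /=.
  by rewrite sumr_const card_ord mulr_natr.
have -> : \sum_(i < e) ((content e kappa i%:Z la)%:R
                        - (content e kappa (i%:Z + 1) la)%:R) ^+ 2
    = \sum_(i < e) ((content e kappa i%:Z mu)%:R
                    - (content e kappa (i%:Z + 1) mu)%:R) ^+ 2 :> rat.
  by apply: eq_bigr => i _; rewrite !contentE; ring.
by ring.
Qed.

End SameHub.

(** * The abacus of a core, seen through a finite window *)

Lemma mem_betas (p : Defs.partition) (a x : int) (N : nat) : (size p <= N)%N ->
  reflect (bead p a x /\ a - N%:Z <= x)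
    (x \in [seq beta p a b | b <- index_iota 0 N]).
Proof.
move=> size_le; apply: (iffP mapP) => [[b]|[[[|b] // _ ->] x_ge]].
  rewrite mem_index_iota /beta => /andP [_ b_lt] ->.
  by split; [exists b.+1 | lia].
exists b => //; rewrite mem_index_iota /=; have [//|N_le] := ltnP b N.
have := part_eq0 p b; rewrite (leq_trans size_le N_le) => /eqP part0.
by move: x_ge; rewrite part0; lia.
Qed.

Lemma betas_uniq (p : Defs.partition) (a : int) (s : seq nat) :
  uniq s -> uniq [seq beta p a b | b <- s].
Proof.
rewrite map_inj_uniq // => b c beta_eq.
by case: (ltngtP b c) => // /(beta_decreasing p a); rewrite beta_eq ltxx.
Qed.

Section CoreAbacus.

Variables (e M N : nat) (p : Defs.partition) (a : int).
Hypotheses (e_gt0 : (0 < e)%N) (p_core : is_core e p).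
(* The first N rows are the beads on levels at least -M, and level -M is full. *)
Hypotheses (NE : N%:Z = a + M%:Z * e%:Z) (N_ge : (size p + e <= N)%N).

Let size_le : (size p <= N)%N.
Proof. exact: leq_trans (leq_addr _ _) N_ge. Qed.

(** The last [e] of the first [N] rows are empty, and their beta-numbers are the [e] positions from
    [a - N], that is [- M * e], upwards. *)
Lemma bead_top (l : 'I_e) : bead p a (- M%:Z * e%:Z + l%:Z).
Proof.
have l_lt := ltn_ord l.
have b_ge : (size p <= N - l.+1)%N by lia.
exists (N - l.+1).+1 => //.
have := beta_vacuum a b_ge; rewrite /beta => ->; lia.
Qed.

Lemma bead_window (l : 'I_e) (k : nat) :
  reflect (bead p a ((k%:Z - M%:Z) * e%:Z + l%:Z))
    ((k%:Z - M%:Z) * e%:Z + l%:Z \in [seq beta p a b | b <- index_iota 0 N]).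
Proof.
apply: (iffP (mem_betas _ _ size_le)) => [[]//|x_bead]; split=> //.
rewrite NE; nia.
Qed.

Lemma core_lowest_level (l : 'I_e) : {x : int | lowest_level p a l x}.
Proof.
pose P k := (k%:Z - M%:Z) * e%:Z + l%:Z \in [seq beta p a b | b <- index_iota 0 N].
have exP : exists k, P k.
  by exists 0%N; apply/bead_window; rewrite add0r; exact: bead_top.
(* The first row has the largest beta-number, and [k <= k * e]. *)
have ubP k : P k -> (k <= absz (beta p a 0 + M%:Z * e%:Z)%R)%N.
  move=> /mapP [b _ kE].
  have : (k%:Z - M%:Z) * e%:Z + l%:Z <= beta p a 0.
    by rewrite kE; case: b {kE} => // b; apply/ltW/beta_decreasing.
  nia.
case: (ex_maxnP exP ubP) => k /bead_window k_bead k_max.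
exists (k%:Z - M%:Z); split=> // y y_bead.
have [y_lt|y_ge] := ltP y (- M%:Z); first by lia.
have y_ge0 : 0 <= y + M%:Z by lia.
suff /k_max : P `|(y + M%:Z)%R|%N by lia.
by apply/bead_window; rewrite gez0_abs // addrK.
Qed.

Variable L : 'I_e -> int.
Hypothesis L_lowest : forall l, lowest_level p a l (L l).

Lemma lowest_level_ge (l : 'I_e) : - M%:Z <= L l.
Proof. exact: (L_lowest l).2 (bead_top l). Qed.

Lemma core_bead (l : 'I_e) (y : int) : bead p a (y * e%:Z + l%:Z) <-> y <= L l.
Proof.
split=> [/(L_lowest l).2 //|y_le].
have -> : y = L l - `|L l - y|%N%:Z by lia.
elim: `|_|%N => [|k /p_core]; first by rewrite subr0; exact: (L_lowest l).1.
by congr bead; rewrite -addn1; lia.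
Qed.

(** The beads are listed by runner instead of by row: in a core, runner [l] is occupied exactly on
    the levels up to [L l], so the window contains its levels from [- M] to [L l]. *)
Lemma core_beta_sum (f : int -> int) :
  \sum_(0 <= b < N) f (beta p a b)
  = \sum_(l < e) \sum_(0 <= k < `|(L l + M%:Z + 1)%R|%N)
      f ((k%:Z - M%:Z) * e%:Z + l%:Z).
Proof.
rewrite -(big_map (beta p a) xpredT f) -big_enum /=.
rewrite -(big_allpairs_dep (h := fun (l : 'I_e) (k : nat) =>
  (k%:Z - M%:Z) * e%:Z + l%:Z)
  (r2 := fun l => index_iota 0 `|(L l + M%:Z + 1)%R|%N)).
apply: perm_big; apply: uniq_perm.
- by apply: betas_uniq; exact: iota_uniq.
- apply: allpairs_uniq_dep => [|l _|[l k] [l' k'] _ _ /= xE].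
  + exact: enum_uniq.
  + exact: iota_uniq.
  have := congr1 (on_runner e l%:Z) xE; rewrite !on_runner_ord eqxx => /esym/eqP lE.
  subst l'; congr existT; apply/eqP; rewrite -eqz_nat.
  move/addIr: xE => /(mulIf (_ : e%:Z != 0)) xE; have : e%:Z != 0 by lia.
  by move/xE => /addIr ->.
move=> x; apply/(mem_betas _ _ size_le)/allpairsPdep => [[x_bead x_ge]|].
  have e_neq0 : e%:Z != 0 by lia.
  have r_ge0 := modz_ge0 x e_neq0.
  have r_lt : (`|(x %% e%:Z)%Z| < e)%N by have := ltz_mod x e_neq0; lia.
  have xE : x = (x %/ e%:Z)%Z * e%:Z + (Ordinal r_lt)%:Z.
    by rewrite /= gez0_abs // -divz_eq.
  move: (x %/ e%:Z)%Z (Ordinal r_lt) xE => y l xE {r_ge0 r_lt}.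
  have l_lt := ltn_ord l.
  have y_ge : - M%:Z <= y by nia.
  have y_le : y <= L l by apply/core_bead; rewrite -xE.
  exists l, `|(y + M%:Z)%R|%N; split; first by rewrite mem_enum.
    by rewrite mem_index_iota; lia.
  by rewrite xE gez0_abs ?addrK //; lia.
case=> l [k [_ k_lt ->]]; move: k_lt; rewrite mem_index_iota => k_lt.
have L_ge := lowest_level_ge l.
split; first by apply/core_bead; lia.
by rewrite NE; nia.
Qed.

(** [core_beta_sum] applied to the indicator function of runner [l]. *)
Lemma core_runner_count (l : 'I_e) :
  \sum_(0 <= b < N) (on_runner e l%:Z (beta p a b))%:Z = L l + M%:Z + 1.
Proof.
rewrite (core_beta_sum (fun x => (on_runner e l%:Z x)%:Z)) (bigD1 l) //=.
rewrite [X in _ + X]big1 => [|l' l'_neq].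
  rewrite (eq_bigr (fun=> 1)) => [|k _]; last by rewrite on_runner_ord eqxx.
  by have := lowest_level_ge l; rewrite big_const_nat iter_addr; lia.
by apply: big1 => k _; rewrite on_runner_ord eq_sym (negPf l'_neq).
Qed.

(** An arithmetic series on each runner; the factor 2 avoids halves. *)
Lemma core_level_sum :
  2 * \sum_(0 <= b < N) (beta p a b %/ e%:Z)%Z
  = \sum_(l < e) (L l + M%:Z + 1) * (L l - M%:Z).
Proof.
have sumE (n : nat) :
    2 * \sum_(0 <= k < n) (k%:Z - M%:Z) = n%:Z * (n%:Z - 1 - 2 * M%:Z).
  elim: n => [|n IHn]; first by rewrite big_nil; lia.
  by rewrite big_nat_recr //= mulrDr IHn; lia.
rewrite (core_beta_sum (fun x => (x %/ e%:Z)%Z)) mulr_sumr; apply: eq_bigr => l _.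
rewrite (eq_bigr (fun k : nat => k%:Z - M%:Z)) => [|k _].
  by rewrite sumE; have := lowest_level_ge l; lia.
have l_lt := ltn_ord l.
by rewrite divzMDl ?divz_small ?addr0 //; lia.
Qed.

End CoreAbacus.

Lemma lowest_level_uniq (e : nat) (p : Defs.partition) (a : int) (l : 'I_e)
    (x y : int) : lowest_level p a l x -> lowest_level p a l y -> x = y.
Proof. by move=> [xb xmax] [yb ymax]; apply/le_anti; rewrite ymax ?xmax. Qed.

(** The bead counts on runners [i] and [ord_pred i] give the difference of levels. The correction at
    [i = 0] is the extra empty row of [delta_compE]: it lies at [- M * e - 1], on runner [e - 1]. *)
Lemma core_delta (r e M N : nat) (kappa a : 'I_r -> int) (i : 'I_e) (j : 'I_r)
    (la : multipartition r) (L : 'I_e -> int) :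
  (0 < e)%N -> is_multicharge e kappa a -> is_core e (la j) ->
  N%:Z = a j + M%:Z * e%:Z -> (size (la j) + e <= N)%N ->
  (forall l, lowest_level (la j) (a j) l (L l)) ->
  delta_comp e kappa i%:Z j la = L i - L (ord_pred i) - (i == 0%N :> nat)%:Z.
Proof.
move=> e_gt0 a_mc la_core NE N_ge L_lowest.
have size_le : (size (la j) <= N)%N := leq_trans (leq_addr _ _) N_ge.
rewrite (delta_compE _ a_mc size_le) big_nat_recr //= beta_vacuum //.
have predE (x : int) :
    on_runner e (i%:Z - 1) x = on_runner e (ord_pred i)%:Z x.
  rewrite -on_runner_modl; congr on_runner.
  have i_lt := ltn_ord i; case: i i_lt => [[|k] /= k_lt] _.
    by rewrite add0n -modzDr modz_small ?modn_small; lia.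
  by rewrite /= modnDr modz_small ?modn_small; lia.
rewrite (eq_bigr _ (fun b _ =>
  congr1 (fun u : bool => u%:Z) (predE (beta (la j) (a j) b)))).
rewrite !(core_runner_count e_gt0 la_core NE N_ge L_lowest).
have -> : on_runner e (i%:Z - 1) (a j - N.+1%:Z) = (i == 0%N :> nat).
  rewrite -(on_runnerD _ _ _ 1) subrK.
  have -> : a j - N.+1%:Z + 1 = - M%:Z * e%:Z + 0 by lia.
  have := on_runner_ord i (Ordinal e_gt0) (- M%:Z); rewrite /= => ->.
  by rewrite -val_eqE.
lia.
Qed.

(** * The weight of a multicore as a quadratic form in its levels *)

Lemma perm_residues_weight (r e : nat) (kappa : 'I_r -> int)
    (la mu : multipartition r) :
  perm_eq (residues e kappa la) (residues e kappa mu) ->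
  weight e kappa la = weight e kappa mu.
Proof.
move=> perm_la_mu.
have contentE i : content e kappa i la = content e kappa i mu.
  have countE nu : content e kappa i nu
      = count (pred1 (i %% e%:Z)%Z) (residues e kappa nu) by rewrite count_map.
  by rewrite !countE; apply/permP.
rewrite /weight; congr (_ - _ * _).
  by apply: eq_bigr => j _; rewrite contentE.
by apply: eq_bigr => i _; rewrite !contentE.
Qed.

Lemma ord_pred_neq (e : nat) (i : 'I_e) : (2 <= e)%N -> ord_pred i != i.
Proof.
move=> e_ge2; rewrite -val_eqE /=; case: i => [[|k] /= k_lt].
  by rewrite add0n modn_small; lia.
by rewrite modnDr modn_small; lia.
Qed.

Lemma window_exists (r e : nat) (a : 'I_r -> int) (la mu : multipartition r) :
  (0 < e)%N -> exists (M : nat) (N : 'I_r -> nat), forall j,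
    [/\ (N j)%:Z = a j + M%:Z * e%:Z, (size (la j) + e <= N j)%N
      & (size (mu j) + e <= N j)%N].
Proof.
move=> e_gt0.
pose M := (\sum_(j < r) (`|a j| + size (la j) + size (mu j)))%N.
(* [M * e] absorbs the charge and both sizes; the additional level provides the [e] empty rows. *)
exists M.+1, (fun j => `|(a j + M.+1%:Z * e%:Z)%R|%N) => j.
have : (`|a j| + size (la j) + size (mu j) <= M)%N.
  by rewrite /M (bigD1 j) //= leq_addr.
by move=> M_ge; split; nia.
Qed.

(* With b in {L', L' - 1}, the quadratic excess of the levels L over b
   measures the weight, because the linear terms cancel by the hub. *)
Lemma multicore_weight (r e : nat) (kappa a : 'I_r -> int)
    (la mu : multipartition r) (L L' : 'I_r -> 'I_e -> int) (b : 'I_e -> int) :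
  (0 < e)%N -> is_multicharge e kappa a -> same_hub e kappa la mu ->
  is_multicore e la -> is_multicore e mu ->
  (forall j l, lowest_level (la j) (a j) l (L j l)) ->
  (forall j l, lowest_level (mu j) (a j) l (L' j l)) ->
  (forall j l, L' j l = b l \/ L' j l = b l + 1) ->
  2 * (weight e kappa la - weight e kappa mu)
  = (\sum_(j < r) \sum_(l < e) (L j l - b l) * (L j l - b l - 1))%:~R * r%:R.
Proof.
move=> e_gt0 a_mc hub_eq la_core mu_core L_lowest L'_lowest L'_base.
have [M [N window]] := window_exists a la mu e_gt0.
have NE j : (N j)%:Z = a j + M%:Z * e%:Z by case: (window j).
have laN j : (size (la j) + e <= N j)%N by case: (window j).
have muN j : (size (mu j) + e <= N j)%N by case: (window j).
have la_size j := leq_trans (leq_addr _ _) (laN j).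
have mu_size j := leq_trans (leq_addr _ _) (muN j).
rewrite (same_hub_weight e_gt0 a_mc la_size mu_size hub_eq) mulrA.
congr (_ * _); rewrite -[2]/(2%:~R) -intrM; congr _%:~R.
rewrite mulrBr !mulr_sumr.
rewrite (eq_bigr _ (fun j _ =>
  core_level_sum e_gt0 (la_core j) (NE j) (laN j) (L_lowest j))).
rewrite [X in _ - X](eq_bigr _ (fun j _ =>
  core_level_sum e_gt0 (mu_core j) (NE j) (muN j) (L'_lowest j))).
(* Equal hubs give equal bead counts on runner [l], summed over the components. *)
have L_sum l : \sum_(j < r) (L j l - L' j l) = 0.
  have := same_hub_runner e_gt0 a_mc la_size mu_size hub_eq l%:Z.
  rewrite (eq_bigr _ (fun j _ =>
    core_runner_count e_gt0 (la_core j) (NE j) (laN j) (L_lowest j) l)).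
  rewrite [RHS](eq_bigr _ (fun j _ =>
    core_runner_count e_gt0 (mu_core j) (NE j) (muN j) (L'_lowest j) l)).
  move/eqP; rewrite -subr_eq0 -sumrB => /eqP sum0; rewrite -[RHS]sum0.
  by apply: eq_bigr => j _; ring.
rewrite exchange_big [X in _ - X]exchange_big [RHS]exchange_big /= -sumrB.
apply: eq_bigr => l _; apply/eqP; rewrite -subr_eq0 -!sumrB; apply/eqP.
(* [(x - b) * (x - b - 1)] equals [x * (x + 1) - (2 * b + 2) * x + b * (b + 1)] and vanishes at
   [x = L']; subtracting its values at [L] and [L'] leaves this linear term. *)
transitivity ((2 * b l + 2) * \sum_(j < r) (L j l - L' j l)).
  by rewrite mulr_sumr; apply: eq_bigr => j _; case: (L'_base j l) => ->; ring.
by rewrite L_sum mulr0.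
Qed.

(** * The lower bound for a single component, and the conclusion *)

(** No integer lies strictly between 0 and 1. *)
Lemma prod_pred_ge0 (x : int) : 0 <= x * (x - 1).
Proof. nia. Qed.

Lemma core_delta_bound (e : nat) (i : 'I_e) (L b : 'I_e -> int) :
  (2 <= e)%N ->
  2 * (b i - b (ord_pred i) - 1 - (L i - L (ord_pred i)))
  <= \sum_(l < e) (L l - b l) * (L l - b l - 1).
Proof.
move=> e_ge2; rewrite (bigD1 i) //= (bigD1 (ord_pred i)) ?ord_pred_neq //=.
have rest_ge0 : 0 <= \sum_(l < e | (l != i) && (l != ord_pred i))
    (L l - b l) * (L l - b l - 1) by apply: sumr_ge0 => l _; exact: prod_pred_ge0.
(* With [x] and [y] the excesses of [L] over [b] on runners [i] and [ord_pred i], the products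
   [(x + 1) * x] and [(y - 1) * (y - 2)] yield the two linear estimates. *)
have := prod_pred_ge0 (L i - b i + 1).
have := prod_pred_ge0 (L (ord_pred i) - b (ord_pred i) - 1).
set s := \sum_(l < e | _) _ in rest_ge0 *.
by nia.
Qed.

Theorem proposition4p8
  (r : nat) (r_gt0 : (0 < r)%N)
  (F : fieldType) (e : nat) (e_ge2 : (2 <= e)%N)
  (q : F) (q_prim : e.-primitive_root q)
  (kappa : 'I_r -> int)
  (i : 'I_e)
  (n : nat) (C : multipartition r -> Prop)
  (C_core : is_core_block e kappa n C)
  (a : 'I_r -> int) (a_mc : is_multicharge e kappa a)
  (K : int) (K_def : is_K C a i K)
  (m : multipartition r)
  (m_core : is_multicore e m)
  (C_of_m : block_has_hub_of e kappa C m)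
  (wC : rat) (wC_def : block_has_weight e kappa C wC)
  (h : int) (h_range : 0 <= h <= K)
  (w_m : weight e kappa m = wC + h%:~R * r%:R) :
  K - h <= min_delta e kappa r_gt0 i%:Z m.
Proof.
have e_gt0 : (0 < e)%N := ltnW e_ge2.
have [[la _ C_block] C_cores] := C_core.
have [mu C_mu hub_eq] := C_of_m.
have mu_core := C_cores mu C_mu.
(* The weight is constant on the block, so [mu] can replace the element that defines [wC]. *)
have wC_mu : wC = weight e kappa mu.
  have [nu C_nu <-] := wC_def.
  rewrite -(perm_residues_weight ((C_block mu).1 C_mu).2).
  by rewrite -(perm_residues_weight ((C_block nu).1 C_nu).2).
have [b [b_base _ _ ->]] := K_def.
have [M [N window]] := window_exists a m mu e_gt0.
have m_level j (l : 'I_e) : {x : int | lowest_level (m j) (a j) l x}.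
  by have [NE m_N _] := window j; exact: core_lowest_level e_gt0 NE m_N l.
have mu_level j (l : 'I_e) : {x : int | lowest_level (mu j) (a j) l x}.
  by have [NE _ mu_N] := window j; exact: core_lowest_level e_gt0 NE mu_N l.
pose L j l := sval (m_level j l); pose L' j l := sval (mu_level j l).
have L_lowest j l : lowest_level (m j) (a j) l (L j l) := svalP (m_level j l).
have L'_lowest j l : lowest_level (mu j) (a j) l (L' j l) := svalP (mu_level j l).
have L'_base j l : L' j l = b l \/ L' j l = b l + 1.
  by case: (b_base l j mu C_mu) => /(lowest_level_uniq (L'_lowest j l)); auto.
have weightE := multicore_weight e_gt0 a_mc hub_eq m_core mu_core
  L_lowest L'_lowest L'_base.
(* The weight difference is [h * r], and the factor [r] cancels in the rationals. *)
have h_sum : 2 * h = \sum_(j < r) \sum_(l < e) (L j l - b l) * (L j l - b l - 1).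
  have r_neq0 : r%:R != 0 :> rat by rewrite pnatr_eq0 -lt0n.
  apply: (@intr_inj rat); apply: (mulIf r_neq0); rewrite -weightE w_m wC_mu.
  by rewrite intrM; ring.
(* The initial value of the minimum is itself the value at a component, so a bound valid for every
   [j] covers it too. *)
suff delta_ge j : b i - b (ord_pred i) - (if i == 0%N :> nat then 2 else 1) - h
    <= delta_comp e kappa i%:Z j m by exact: le_bigmin.
have [NE m_N _] := window j.
rewrite (core_delta i e_gt0 a_mc (m_core j) NE m_N (L_lowest j)).
have := core_delta_bound i (L j) b e_ge2.
(* The other components contribute nonnegative terms to [h_sum]. *)
have : \sum_(l < e) (L j l - b l) * (L j l - b l - 1) <= 2 * h.
  rewrite h_sum (bigD1 j) //= lerDl; apply: sumr_ge0 => k _.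
  by apply: sumr_ge0 => l _; exact: prod_pred_ge0.
(* At [i = 0] the additional 1 subtracted in [K] matches the correction in [core_delta]. *)
by case: (i == 0%N :> nat); lia.
Qed.
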